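(* Let $W=\mathfrak{S}_n$, $\ast=\mathrm{id}$, and let $w\in I_\ast$. Then any two reduced $I_\ast$-expressions for $w$ can be transformed into each other through a finite series of braid $I_\ast$-transformations (each intermediate sequence being a reduced $I_\ast$-expression for $w$).
   Context: $\mathfrak{S}_n$ is the symmetric group with simple transpositions $s_i=(i,i+1)$, $1\le i<n$, $S=\{s_1,\dots,s_{n-1}\}$; $I_\ast=\{w\in\mathfrak{S}_n:w^2=1\}$. For $s\in S$ and $w\in I_\ast$ set $s\ltimes w=sw$ if $sw=ws$, and $s\ltimes w=sws$ if $sw\neq ws$ (so $s\ltimes 1=s$); iterated: $s_{i_1}\ltimes s_{i_2}\ltimes\cdots\ltimes s_{i_k}\ltimes w=s_{i_1}\ltimes(s_{i_2}\ltimes(\cdots(s_{i_k}\ltimes w)\cdots))$. A sequence $(s_{i_1},\dots,s_{i_k})$ is an $I_\ast$-expression for $w$ if $w=s_{i_1}\ltimes\cdots\ltimes s_{i_k}\ltimes 1$ (the empty sequence being an expression for $1$); it is reduced if $k$ is minimal among all $I_\ast$-expressions of $w$; this minimal $k$ is denoted $\rho(w)$. A braid $I_\ast$-transformation of a reduced $I_\ast$-expression is one of: (i) replacing a consecutive block $(s_j,s_{j+1},s_j)$ by $(s_{j+1},s_j,s_{j+1})$ or vice versa ($1\le j<n-1$); (ii) replacing a consecutive block $(s_b,s_c)$ with $|b-c|>1$ by $(s_c,s_b)$; (iii) replacing the last two entries $(s_k,s_{k+1})$ of the sequence by $(s_{k+1},s_k)$ or vice versa ($1\le k<n-1$); in each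 case both the original and the resulting sequences are required to be reduced. *)

(* Defs.v *)
From Stdlib Require Import Relations.
From mathcomp Require Import all_boot all_order all_fingroup.

Import GroupScope.

(* Symmetric group S_n = {perm 'I_n}; the simple transposition s_i (1 <= i < n)
   swaps the (0-based) points i-1 and i, i.e. the 1-based points i and i+1.
   Outside the range 1 <= i < n the value is irrelevant (never used: all
   expressions are required to have entries in [1, n-1]). *)
Definition sgen (n i : nat) : {perm 'I_n} :=
  match (insub i : option 'I_n), (insub i.-1 : option 'I_n) with
  | Some a, Some b => tperm a b
  | _, _ => 1
  end.

Definition ltimes (n i : nat) (w : {perm 'I_n}) : {perm 'I_n} :=
  let s := sgen n i in
  if s * w == w * s then s * w else s * w * s.

Definition ev (n : nat) (l : seq nat) : {perm 'I_n} := foldr (ltimes n) (1 : {perm 'I_n}) l.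

Definition valid (n : nat) (l : seq nat) : bool := all (fun i => 0 < i < n) l.

Definition is_expr (n : nat) (l : seq nat) (w : {perm 'I_n}) : Prop :=
  valid n l /\ ev n l = w.

Definition reduced (n : nat) (l : seq nat) : Prop :=
  valid n l /\ forall l', is_expr n l' (ev n l) -> size l <= size l'.

Definition braid_move_raw (n : nat) (l l' : seq nat) : Prop :=
  (exists (a b : seq nat) (j : nat), 0 < j /\ j.+1 < n /\
     ((l = a ++ [:: j; j.+1; j] ++ b /\ l' = a ++ [:: j.+1; j; j.+1] ++ b) \/
      (l = a ++ [:: j.+1; j; j.+1] ++ b /\ l' = a ++ [:: j; j.+1; j] ++ b)))
  \/
  (exists (a r : seq nat) (b c : nat), (b.+1 < c \/ c.+1 < b) /\
     l = a ++ [:: b; c] ++ r /\ l' = a ++ [:: c; b] ++ r)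
  \/
  (exists (a : seq nat) (k : nat), 0 < k /\ k.+1 < n /\
     ((l = a ++ [:: k; k.+1] /\ l' = a ++ [:: k.+1; k]) \/
      (l = a ++ [:: k.+1; k] /\ l' = a ++ [:: k; k.+1]))).

Definition braid_move (n : nat) (l l' : seq nat) : Prop :=
  reduced n l /\ reduced n l' /\ braid_move_raw n l l'.

Definition braid_move_for (n : nat) (w : {perm 'I_n}) (l l' : seq nat) : Prop :=
  braid_move n l l' /\ is_expr n l w /\ is_expr n l' w.

(* Main.v *)
(* Say that two words are equivalent if raw braid moves connect them.
   (1) Every word is equivalent to one with a factor s_j s_j, or to a normal
   word: a concatenation of runs s_m s_{m+1} ... s_{N-1} in which N drops by at
   least 2 from one run to the next. This is an induction on the length, pushing
   one more letter through a normal word; the moves on the last two letters apply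
   inside a word whenever the letters behind commute with the two in question.
   (2) A normal word is determined by the involution it represents: the first run
   s_m ... s_{N-1} gives the largest moved point N and its image m.
   (3) A raw move applied to a reduced word preserves its value: the orbit of an
   involution under two braiding generators is a hexagon, where both sides of the
   braid relation agree, or a square, where acting by s, t, s has the same effect
   as acting by t, contradicting minimality. So does a factor s_j s_j.
   Hence all reduced words of w are equivalent, through reduced words, to the one
   normal word of w. *)
Require Import Defs.
From Stdlib Require Import Relations.
From mathcomp Require Import all_boot all_order all_fingroup.
From mathcomp Require Import zify.
Import GroupScope.

(** * The operation of [ltimes] in an arbitrary finite group *)

Section Twist.
Context {gT : finGroupType}.
Implicit Types s t u w : gT.

Definition twist s w : gT := if s * w == w * s then s * w else s * w * s.

Lemma twist_comm s w : s * w = w * s -> twist s w = s * w.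
Proof. by rewrite /twist => ->; rewrite eqxx. Qed.

Lemma twist_conj s w : s * w <> w * s -> twist s w = s * w * s.
Proof. by rewrite /twist => /eqP/negbTE ->. Qed.

(** [twist s w] commutes with [s] exactly when [w] does, so both applications take the same
    branch. *)
Lemma twistK s w : s * s = 1 -> twist s (twist s w) = w.
Proof.
move=> ss; have cK x : x * s * s = x by rewrite -mulgA ss mulg1.
have Kc x : s * (s * x) = x by rewrite mulgA ss mul1g.
have [c|c] := eqVneq (s * w) (w * s).
  by rewrite (twist_comm _ _ c) twist_comm ?Kc // c cK.
move/eqP: c => c; rewrite (twist_conj _ _ c) -mulgA twist_conj; last first.
  by rewrite Kc mulgA cK => /esym.
by rewrite Kc cK.
Qed.

Lemma twist_sq s w : s * s = 1 -> w * w = 1 -> twist s w * twist s w = 1.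
Proof.
move=> ss ww; have cK x : x * s * s = x by rewrite -mulgA ss mulg1.
have wK x : x * w * w = x by rewrite -mulgA ww mulg1.
have [c|/eqP c] := eqVneq (s * w) (w * s).
  by rewrite (twist_comm _ _ c) {1}c mulgA cK ww.
by rewrite (twist_conj _ _ c) !mulgA cK wK ss.
Qed.

(** Twisting by one of [s], [t] does not affect whether the other commutes with the element, so both
    sides take the same branches. *)
Lemma twist_commute s t u : s * s = 1 -> t * t = 1 -> s * t = t * s ->
  twist s (twist t u) = twist t (twist s u).
Proof.
move=> ss tt st.
have sK x : s * (s * x) = x by rewrite mulgA ss mul1g.
have tK x : t * (t * x) = x by rewrite mulgA tt mul1g.
have stK x : s * (t * x) = t * (s * x) by rewrite !mulgA st.
have aux a b : a * a = 1 -> b * b = 1 -> a * b = b * a ->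
    (a * twist b u == twist b u * a) = (a * u == u * a).
  move=> aa bb ab; have aK x : a * (b * x) = b * (a * x) by rewrite !mulgA ab.
  rewrite /twist; case: ifP => _.
    by rewrite aK -?mulgA (inj_eq (mulgI b)).
  rewrite !mulgA ab -?mulgA -ab !mulgA (inj_eq (mulIg b)) -?mulgA.
  by rewrite (inj_eq (mulgI b)).
rewrite {1}/twist aux // [RHS]/twist aux //.
rewrite /twist.
by case: ifP => _; case: ifP => _; rewrite -?mulgA ?stK ?st.
Qed.

(** Reduces branch conditions in the braid relation to commutation of [u] with [s], [t] or
    [s * t * s]. *)
Lemma comm_conj (g x v : gT) : g * g = 1 ->
  x * (g * v * g) = g * v * g * x <-> g * x * g * v = v * (g * x * g).
Proof.
move=> gg; have gK y : g * (g * y) = y by rewrite mulgA gg mul1g.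
split=> [e|e].
  apply: (mulgI g); apply: (mulIg g); move: e; rewrite -?mulgA => e.
  by rewrite gK gg mulg1 e.
apply: (mulgI g); apply: (mulIg g); move: e; rewrite -?mulgA => e.
by rewrite gg mulg1 e gK.
Qed.

Section Braid.
Variables s t u : gT.
Hypotheses (ss : s * s = 1) (tt : t * t = 1) (sts : s * t * s = t * s * t).
Hypotheses (neq_st : s <> t) (uu : u * u = 1).

Let sK x : s * (s * x) = x. Proof. by rewrite mulgA ss mul1g. Qed.
Let tK x : t * (t * x) = x. Proof. by rewrite mulgA tt mul1g. Qed.
Let uK x : u * (u * x) = x. Proof. by rewrite mulgA uu mul1g. Qed.
Let sts' : s * (t * s) = t * (s * t). Proof. by move: sts; rewrite -?mulgA. Qed.
Let stsK x : s * (t * (s * x)) = t * (s * (t * x)).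
Proof. by rewrite !mulgA sts. Qed.

Let nst : s * t <> t * s.
Proof.
move=> e; apply: neq_st; move: sts; by rewrite e -?mulgA ss mulg1 e tK => /esym.
Qed.

Let W := (sK, tK, uK, ss, tt, uu, @mulg1 gT, stsK, sts').

Lemma twist_braid_comm : s * u = u * s ->
  twist s (twist t (twist s u)) = twist t (twist s (twist t u)) \/
  twist s (twist t (twist s u)) = twist t u.
Proof.
move=> su; have us := esym su.
have usK x : u * (s * x) = s * (u * x) by rewrite !mulgA su.
rewrite (twist_comm _ _ su).
have [tu|/eqP tu] := eqVneq (t * u) (u * t).
  have ut := esym tu.
  have utK x : u * (t * x) = t * (u * x) by rewrite !mulgA tu.
  right; rewrite (twist_comm _ _ tu) (twist_conj t).
    rewrite twist_conj; first by rewrite -?mulgA ?(W, us, ut, usK, utK).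
    rewrite -?mulgA ?(W, us, ut, usK, utK) !mulgA => /mulIg /esym; exact: nst.
  by rewrite -?mulgA ut !mulgA => /mulIg /esym; exact: nst.
rewrite (twist_conj _ _ tu).
(* Equivalently, [t] commutes with [s * u]; conjugation by [u] then exchanges [t] and
   [s * t * s]. *)
have [ru|/eqP ru] := eqVneq (s * t * s * u) (u * t).
  have ut : u * t = t * (s * (t * u)) by rewrite -ru -?mulgA ?W.
  right; rewrite (twist_comm t); last first.
    by rewrite -?mulgA ut ?W.
  rewrite twist_conj; last first.
    rewrite -?mulgA us ?W => e; apply: tu.
    by rewrite ut e.
  by rewrite -?mulgA us ut ?W.
left; rewrite (twist_conj t (s * u)); last first.
  move=> e; apply: ru; apply: (mulgI s); move: e.
  by rewrite -?mulgA ?W.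
rewrite twist_conj; last first.
  move/(comm_conj t _ _ tt) => e; apply: ru.
  apply: (mulIg s); move: e; rewrite -?mulgA ?(W, us, usK).
  by rewrite -sts' usK sK.
rewrite (twist_conj s (t * u * t)); last first.
  move/(comm_conj t _ _ tt) => e; apply: tu.
  move: e; rewrite -?mulgA ?(W, us, usK) -sts' -stsK usK => /mulgI.
  by rewrite -us !mulgA => /mulIg.
rewrite [RHS]twist_comm; last first.
  apply/(comm_conj s _ _ ss)/(comm_conj t _ _ tt).
  by rewrite -?mulgA ?(W, us).
by rewrite -?mulgA ?W.
Qed.

(** The second twist is a multiplication on both sides. The orbit is a square if conjugation by [u]
    exchanges [s] and [t], and a hexagon otherwise. *)
Lemma twist_braid_refl : s * t * s * u = u * (s * t * s) ->
  s * u <> u * s -> t * u <> u * t ->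
  twist s (twist t (twist s u)) = twist t (twist s (twist t u)) \/
  twist s (twist t (twist s u)) = twist t u.
Proof.
move=> ru su tu; rewrite (twist_conj _ _ su) (twist_conj _ _ tu).
rewrite (twist_comm t); last by apply/(comm_conj s _ _ ss).
rewrite (twist_comm s (t * u * t)); last first.
  by apply/(comm_conj t _ _ tt); rewrite -sts.
have swap a b : a * a = 1 -> u * a = b * u -> u * b = a * u.
  by move=> aa e; rewrite -[b]mulg1 -uu (mulgA b) -e -?mulgA uK.
have [us|/eqP us] := eqVneq (u * s) (t * u).
  have ut := swap s t ss us.
  by right; rewrite twist_comm -?mulgA ?(W, us, ut).
left; rewrite twist_conj; last first.
  rewrite -?mulgA ?W => /mulgI/mulgI e; apply: us.
  by rewrite -{2}e tK.
rewrite (twist_conj t); last first.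
  rewrite -?mulgA ?W -stsK => /mulgI/mulgI e; apply: us; apply: swap => //.
  by rewrite -{2}e sK.
by rewrite -?mulgA ?W.
Qed.

(** Every twist is a conjugation, so both sides are [u] conjugated by [s * t * s]. *)
Lemma twist_braid_free :
  s * u <> u * s -> t * u <> u * t -> s * t * s * u <> u * (s * t * s) ->
  twist s (twist t (twist s u)) = twist t (twist s (twist t u)).
Proof.
move=> su tu ru; rewrite (twist_conj _ _ su) (twist_conj _ _ tu).
rewrite (twist_conj t); last by move/(comm_conj s _ _ ss).
rewrite (twist_conj s (t * u * t)); last first.
  by move/(comm_conj t _ _ tt); rewrite -sts.
rewrite twist_conj; last first.
  by move/(comm_conj t _ _ tt)/(comm_conj s _ _ ss); rewrite -?mulgA ?W.
rewrite twist_conj; last first.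
  by move/(comm_conj s _ _ ss)/(comm_conj t _ _ tt); rewrite -?mulgA ?W.
by rewrite -?mulgA ?W.
Qed.
End Braid.

(* Under the group generated by twist s and twist t, the orbit of u is a
   hexagon (first case) or a square (second case). *)
Lemma twist_braid s t u :
  s * s = 1 -> t * t = 1 -> s * t * s = t * s * t -> s <> t -> u * u = 1 ->
  twist s (twist t (twist s u)) = twist t (twist s (twist t u)) \/
  twist s (twist t (twist s u)) = twist t u.
Proof.
move=> ss tt sts st uu.
have [su|/eqP su] := eqVneq (s * u) (u * s); first exact: twist_braid_comm.
have [tu|/eqP tu] := eqVneq (t * u) (u * t).
  have ts : t <> s by move=> /esym/st.
  case: (twist_braid_comm t s u tt ss (esym sts) ts tu) => e; first by left.
  by right; rewrite -e !twistK.
have [ru|/eqP ru] := eqVneq (s * t * s * u) (u * (s * t * s)).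
  exact: twist_braid_refl.
by left; apply: twist_braid_free.
Qed.

End Twist.

(** * Equivalence of words under raw braid moves *)

Definition braid_eq n := clos_refl_trans (seq nat) (braid_move_raw n).

Lemma braid_move_raw_sym n l l' : braid_move_raw n l l' -> braid_move_raw n l' l.
Proof.
case=> [[a [b [j [j0 [jn H]]]]]|[[a [r [b [c [bc [-> ->]]]]]]|[a [k [k0 [kn H]]]]]].
- by left; exists a, b, j; split; [|split]; rewrite // or_comm; tauto.
- by right; left; exists a, r, c, b; split; [case: bc; auto|].
- by right; right; exists a, k; split; [|split]; rewrite // or_comm; tauto.
Qed.

(** Only prefixes may be added: a suffix would spoil the move on the last two letters. *)
Lemma braid_move_raw_cat n p l l' :
  braid_move_raw n l l' -> braid_move_raw n (p ++ l) (p ++ l').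
Proof.
case=> [[a [b [j [j0 [jn H]]]]]|[[a [r [b [c [bc [-> ->]]]]]]|[a [k [k0 [kn H]]]]]].
- left; exists (p ++ a), b, j; split; [|split]; rewrite // -!catA.
  by case: H => -[-> ->]; [left|right].
- by right; left; exists (p ++ a), r, b, c; rewrite -!catA.
- right; right; exists (p ++ a), k; split; [|split]; rewrite // -!catA.
  by case: H => -[-> ->]; [left|right].
Qed.

Section Words.
Variable n : nat.
Local Notation "x ~~ y" := (braid_eq n x y) (at level 70).

Lemma braid_eq_refl x : x ~~ x. Proof. exact: rt_refl. Qed.

Lemma braid_eq_trans y x z : x ~~ y -> y ~~ z -> x ~~ z.
Proof. exact: rt_trans. Qed.

Lemma braid_eq_sym x y : x ~~ y -> y ~~ x.
Proof.
elim=> [a b /braid_move_raw_sym|a|a b c _ ab _ bc].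
- exact: rt_step.
- exact: rt_refl.
- exact: rt_trans bc ab.
Qed.

Lemma braid_eq_cat p x y : x ~~ y -> p ++ x ~~ p ++ y.
Proof.
elim=> [a b /(braid_move_raw_cat _ p)|a|a b c _ ab _ bc].
- exact: rt_step.
- exact: rt_refl.
- exact: rt_trans ab bc.
Qed.

Lemma braid_eq_cons i x y : x ~~ y -> i :: x ~~ i :: y.
Proof. exact: (braid_eq_cat [:: i]). Qed.

Definition far i j := (i.+1 < j) || (j.+1 < i).

Lemma braid_eq_far i w r : all (far i) w -> i :: w ++ r ~~ w ++ i :: r.
Proof.
elim: w => [|j w IH] /=; first by move=> _; exact: braid_eq_refl.
case/andP=> ij /IH/(braid_eq_cons j); apply: braid_eq_trans.
apply: rt_step; right; left; exists [::], (w ++ r), i, j; split=> //.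
exact/orP.
Qed.

Lemma braid_eq_far_cat v w r :
  all (fun i => all (far i) w) v -> v ++ w ++ r ~~ w ++ v ++ r.
Proof.
elim: v => [|i v IH] /=; first by move=> _; exact: braid_eq_refl.
case/andP=> iw /IH/(braid_eq_cons i)/braid_eq_trans; apply.
exact: braid_eq_far.
Qed.

(** Both letters commute with all of [w]: they travel to the end, are exchanged there, and travel
    back. *)
Lemma braid_eq_end k w : 0 < k -> k.+1 < n -> all (fun i => i.+1 < k) w ->
  [:: k, k.+1 & w] ~~ [:: k.+1, k & w].
Proof.
move=> k0 kn kw.
have fw j : k <= j -> all (far j) w.
  by move=> kj; apply: sub_all kw => i; rewrite /far; lia.
have mv i j : k <= i -> k <= j -> [:: i, j & w] ~~ w ++ [:: i; j].
  move=> ki kj; rewrite -[w in X in X ~~ _]cats0 -2!cat_cons.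
  apply: (@braid_eq_trans (i :: w ++ [:: j])).
    by apply: braid_eq_cons; apply: braid_eq_far; apply: fw.
  by apply: braid_eq_far; apply: fw.
apply: braid_eq_trans (mv _ _ _ _) _ => //.
apply: braid_eq_trans (braid_eq_sym _ _ (mv _ _ _ _)) => //.
by apply: rt_step; right; right; exists w, k; do !split=> //; left.
Qed.

(** * Moving letters and runs through runs *)

Definition run m N := iota m (N - m).

Lemma run_cons m N : m < N -> run m N = m :: run m.+1 N.
Proof. by move=> mN; rewrite /run -(prednK (_ : 0 < N - m)) ?subn_gt0 // -subnS. Qed.

Lemma run_cat m k N : m <= k -> k <= N -> run m N = run m k ++ run k N.
Proof.
move=> mk kN; rewrite /run (_ : N - m = (k - m) + (N - k)); last by lia.
by rewrite iotaD subnKC.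
Qed.

Lemma run_nil m : run m m = [::]. Proof. by rewrite /run subnn. Qed.

Lemma run_rcons m k : m <= k -> run m k.+1 = rcons (run m k) k.
Proof. by move=> mk; rewrite (run_cat m k) // (run_cons k) // run_nil cats1. Qed.

Lemma all_run (P : pred nat) m N : (forall i, m <= i < N -> P i) -> all P (run m N).
Proof. by move=> H; apply/allP=> i; rewrite mem_iota => Hi; apply: H; lia. Qed.

(** The letter commutes up to [i.-1]; there [i, i-1, i] becomes [i-1, i, i-1], whose last letter
    commutes with the rest of the run. *)
Lemma braid_eq_run m i N r : m < i < N -> 0 < m -> N <= n ->
  i :: run m N ++ r ~~ run m N ++ i.-1 :: r.
Proof.
case: i => // k /andP[mk kN] m0 Nn.
rewrite !(run_cat m k N) ?(run_cons k N) ?(run_cons k.+1 N) -?catA //=; try lia.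
apply: braid_eq_trans.
  by apply: braid_eq_far; apply: all_run => i; rewrite /far; lia.
apply: braid_eq_cat.
apply: (@braid_eq_trans [:: k, k.+1, k & run k.+2 N ++ r]).
  apply: rt_step; left; exists [::], (run k.+2 N ++ r), k.
  by split; [lia|split; [lia|right]].
do 2!apply: braid_eq_cons.
by apply: braid_eq_far; apply: all_run => i; rewrite /far; lia.
Qed.

(** The letters of the first run pass one by one, the last one first, each dropping by 1. *)
Lemma braid_eq_run2 p a K r : 0 < p <= a -> a < K -> K <= n ->
  run a.+1 K ++ run p K ++ r ~~ run p K ++ run a K.-1 ++ r.
Proof.
move=> /andP[p0 pa] aK Kn; have [d dE] : {d | d = K.-1 - a} by exists (K.-1 - a).
elim: d => [|d IH] in a pa aK dE *.
  have -> : K = a.+1 by lia.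
  by rewrite /= !run_nil; apply: braid_eq_refl.
rewrite (run_cons a.+1 K) ?(run_cons a K.-1) /=; try lia.
apply: braid_eq_trans; first by apply: braid_eq_cons; apply: IH; lia.
by apply: (braid_eq_run p a.+1 K); lia.
Qed.

(** The top letters [N-1] and [N-2] are brought together and exchanged. The shortened first run then
    passes through the second, which [N-1] finally completes to [run p N]. *)
Lemma braid_eq_run_end p N r : 0 < p -> p.+1 < N -> N <= n ->
  all (fun i => i.+3 < N) r ->
  run p.+1 N ++ run p N.-1 ++ r ~~ run p N ++ run p N.-2 ++ r.
Proof.
case: N => [|[|N]] // p0 pN Nn rN.
rewrite /= (run_rcons p.+1 N.+1) ?(run_rcons p N) ?(run_rcons p N.+1) //; try lia.
rewrite !cat_rcons.
apply: (@braid_eq_trans (run p.+1 N.+1 ++ run p N ++ [:: N.+1, N & r])).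
  apply: braid_eq_cat; apply: (braid_eq_far N.+1 _ (N :: r)).
  by apply: all_run => i; rewrite /far; lia.
apply: (@braid_eq_trans (run p.+1 N.+1 ++ run p N ++ [:: N, N.+1 & r])).
  do 2!apply: braid_eq_cat; apply/braid_eq_sym/braid_eq_end; try lia.
  by apply: sub_all rN => i; lia.
rewrite -cat_rcons -run_rcons; last by lia.
apply: braid_eq_trans; first by apply: (braid_eq_run2 p p N.+1); lia.
rewrite /=; apply: braid_eq_cat; apply: braid_eq_sym.
by apply: braid_eq_far; apply: all_run => i; rewrite /far; lia.
Qed.

(* The run [m; ...; N-1] creates the 2-cycle (m N) on top of the involution of
   the N-2 other points encoded by the rest of the word, so normal words inside
   S_B correspond to the involutions of S_B. *)
Inductive normal_word : nat -> seq nat -> Prop :=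
| normal_nil B : normal_word B [::]
| normal_run B m N r :
    0 < m < N -> N <= B -> normal_word N.-2 r -> normal_word B (run m N ++ r).

Lemma normal_mono B B' x : B <= B' -> normal_word B x -> normal_word B' x.
Proof.
move=> le nx; case: nx le => [C|C m N r mN NC nr] CB; first exact: normal_nil.
by apply: normal_run => //; lia.
Qed.

Lemma normal_lt B x : normal_word B x -> all (fun i => 0 < i < B) x.
Proof.
elim=> // C m N r mN NC _ IH; rewrite all_cat all_run /=; last by lia.
by apply: sub_all IH => i; lia.
Qed.

(** * Reduction of words to normal words or squares *)

Definition squareful x := exists a j b, x ~~ a ++ [:: j, j & b].

Lemma squareful_eq x y : x ~~ y -> squareful y -> squareful x.
Proof. by move=> xy [a [j [b H]]]; exists a, j, b; apply: braid_eq_trans H. Qed.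

Lemma squareful_cat p x : squareful x -> squareful (p ++ x).
Proof.
by move=> [a [j [b H]]]; exists (p ++ a), j, b; rewrite -catA; apply: braid_eq_cat.
Qed.

Definition normalizable B x := (exists2 y, normal_word B y & x ~~ y) \/ squareful x.

Lemma normalizable_eq B x y : x ~~ y -> normalizable B y -> normalizable B x.
Proof.
move=> xy [[z nz yz]|d]; last by right; apply: squareful_eq d.
by left; exists z => //; apply: braid_eq_trans yz.
Qed.

Lemma normalizable_run B m N x : 0 < m < N -> N <= B ->
  normalizable N.-2 x -> normalizable B (run m N ++ x).
Proof.
move=> mN NB [[y ny xy]|d]; last by right; apply: squareful_cat.
by left; exists (run m N ++ y); [apply: normal_run|apply: braid_eq_cat].
Qed.

Lemma normal_normalizable B x : normal_word B x -> normalizable B x.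
Proof. by move=> nx; left; exists x => //; apply: braid_eq_refl. Qed.

(** The cases are whether the involution fixes or moves the point [B.+1]. *)
Lemma normal_split B x : normal_word B.+1 x ->
  normal_word B x \/
  exists m r, [/\ 0 < m <= B, x = run m B.+1 ++ r & normal_word B.-1 r].
Proof.
move Bx: B.+1 => B' nx; case: nx Bx => [C|C m N r mN NC nr] BC.
  by left; apply: normal_nil.
have [NB|NB] := leqP N B; first by left; apply: normal_run.
have NE : N = B.+1 by lia.
by subst N C; right; exists m, r.
Qed.

(* The word [run m q.+3 ++ run p q.+2 ++ r] arises from s_{N-1} acting on an
   involution moving both N and N-1 (N = q+3): the two 2-cycles exchange their
   tops, unless s_{N-1} is a descent and a square appears. *)
Lemma normalizable_double_run B m p q r : 0 < m <= q.+1 -> 0 < p <= q ->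
  q.+2 < B -> B <= n -> normal_word q.-1 r ->
  normalizable B (run m q.+3 ++ run p q.+2 ++ r).
Proof.
move=> mq pq qB Bn nr.
have r_lt : all (fun i => i.+3 < q.+3) r.
  by apply: sub_all (normal_lt _ _ nr) => i; lia.
have [mp|pm] := leqP m p.
  (* By [braid_eq_run_end], what follows the first [p] can be rewritten to begin with [p] again. *)
  right; rewrite (run_cat m p) ?(run_cons p q.+3) -?catA; try lia.
  exists (run m p), p, (run p.+1 q.+3 ++ run p q.+1 ++ r).
  apply: braid_eq_cat; rewrite /=; apply: braid_eq_cons.
  rewrite -cat_cons -run_cons; last by lia.
  by apply: (braid_eq_run_end p q.+3); lia.
(* With [m] lowered by 1, the part [run p m] commutes to the front, and [braid_eq_run_end] applies
   behind it. *)
case: m => // m in mq pm *; rewrite (run_cat p m) -?catA; try lia.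
apply: (@normalizable_eq _ _ (run p m ++ run m.+1 q.+3 ++ run m q.+2 ++ r)).
  apply: braid_eq_far_cat; apply: all_run => i im.
  by apply: all_run => j; rewrite /far; lia.
apply: (@normalizable_eq _ _ (run p m ++ run m q.+3 ++ run m q.+1 ++ r)).
  by apply: braid_eq_cat; apply: (braid_eq_run_end m q.+3); lia.
rewrite catA -run_cat; try lia.
apply: normal_normalizable; apply: normal_run; try lia.
by apply: normal_run => //; lia.
Qed.

(** The letter [N.-2] is just too large for the bound on [r]. Either [r] fixes the point [N-2] and a
    square appears, or the letter extends the first run of [r] to top [N-1]. *)
Lemma normalizable_top B m N r : 0 < m -> m.+1 < N -> N <= B -> B <= n ->
  normal_word N.-2 r -> normalizable B (run m N ++ N.-2 :: r).
Proof.
case: N => [|[|[|k]]] m0 mN NB Bn; try lia.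
move=> /normal_split[nr|[p [s [pk -> ns]]]].
  right; rewrite (run_cat m k.+1) ?(run_cons k.+1) ?(run_cons k.+2); try lia.
  rewrite run_nil -catA; exists (run m k.+1), k.+1, (k.+2 :: r).
  apply: braid_eq_cat; apply: braid_eq_cons; apply: braid_eq_sym.
  apply: braid_eq_end; try lia.
  by apply: sub_all (normal_lt _ _ nr) => i; lia.
apply: (@normalizable_eq _ _ (run m k.+3 ++ run p k.+2 ++ s)).
  apply: braid_eq_cat; rewrite (run_rcons p k.+1) ?(run_rcons p k); try lia.
  rewrite !cat_rcons.
  apply: (@braid_eq_trans (run p k ++ [:: k.+1, k & s])).
    by apply: braid_eq_far; apply: all_run => i; rewrite /far; lia.
  apply: braid_eq_cat; apply: braid_eq_sym; apply: braid_eq_end; try lia.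
  by apply: sub_all (normal_lt _ _ ns) => i; lia.
by apply: normalizable_double_run; try lia.
Qed.

(** Relative to the first run, [i > N] opens a new run, [i = N] and [i = m-1] lengthen it, [i = m]
    gives a square, and any other letter passes through. *)
Lemma normalizable_cons B x i : B <= n -> 0 < i < B -> normal_word B x ->
  normalizable B (i :: x).
Proof.
move=> Bn iB nx; elim: nx => {B x} [B|B m N r mN NB nr IH] in i Bn iB *.
  have -> : [:: i] = run i i.+1 ++ [::] by rewrite run_cons // run_nil.
  by apply/normal_normalizable/normal_run/normal_nil; lia.
have [Ni|iN|iN] := ltngtP N i; last first.
- subst i; case: N => // N in iB mN NB nr IH *.
  apply: (@normalizable_eq _ _ (run m N.+2 ++ r)).
    rewrite (run_rcons m N.+1) ?(run_rcons m N); try lia.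
    rewrite !cat_rcons.
    apply: (@braid_eq_trans (run m N ++ [:: N.+1, N & r])).
      by apply: braid_eq_far; apply: all_run => i; rewrite /far; lia.
    apply: braid_eq_cat; apply: braid_eq_sym; apply: braid_eq_end; try lia.
    by apply: sub_all (normal_lt _ _ nr) => i; lia.
  apply/normal_normalizable/normal_run; try lia.
  by apply: normal_mono nr; lia.
- have [im|mi|im] := ltngtP i m; last first.
  + subst i; right; exists [::], m, (run m.+1 N ++ r).
    by rewrite (run_cons m) /=; [apply: braid_eq_refl|lia].
  + apply: normalizable_eq; first by apply: (braid_eq_run m i N); lia.
    have [iN1|iN1] := eqVneq i N.-1.
      by rewrite iN1; apply: normalizable_top => //; lia.
    by apply: normalizable_run => //; apply: IH; lia.
  + have [im1|im1] := eqVneq i.+1 m.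
      rewrite -cat_cons -im1 -run_cons; last by lia.
      by apply/normal_normalizable/normal_run => //; lia.
    apply: (@normalizable_eq _ _ (run m N ++ i :: r)).
      by apply: braid_eq_far; apply: all_run => j; rewrite /far; lia.
    by apply: normalizable_run => //; apply: IH; lia.
- have -> : i :: run m N ++ r = run i i.+1 ++ run m N ++ r.
    by rewrite (run_cons i) // run_nil.
  apply/normal_normalizable/normal_run; try lia.
  by apply: normal_run => //; lia.
Qed.

Lemma valid_normalizable l : valid n l -> normalizable n l.
Proof.
elim: l => [|i l IH] /=; first by move=> _; apply/normal_normalizable/normal_nil.
case/andP=> i_n /IH [[y ny ly]|d]; last first.
  by right; apply: (squareful_cat [:: i]).
apply: normalizable_eq (braid_eq_cons i _ _ ly) _.
exact: normalizable_cons.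
Qed.
End Words.

(** * Values of words and reducedness *)

Section Perms.
Variable n : nat.
Implicit Types (i j m : nat) (w : {perm 'I_n}) (l : seq nat).

Lemma ltimesE i w : ltimes n i w = twist (sgen n i) w.
Proof. by []. Qed.

Lemma sgen_val i (x : 'I_n) : 0 < i < n ->
  sgen n i x = (if x == i :> nat then i.-1 else if x == i.-1 :> nat then i else x) :> nat.
Proof.
move=> /andP[i0 ltin]; rewrite /sgen.
have lt1 : i.-1 < n by lia.
rewrite (insubT (fun k => k < n) ltin) (insubT (fun k => k < n) lt1) /=.
case: tpermP => [->|->|/eqP xa /eqP xb] /=; rewrite ?eqxx //.
  by case: eqP => //; lia.
by rewrite -!val_eqE /= in xa xb; rewrite (negbTE xa) (negbTE xb).
Qed.

Lemma sgen_sq i : sgen n i * sgen n i = 1.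
Proof.
by rewrite /sgen; case: insub => [a|]; [case: insub => [b|]|]; rewrite ?tperm2 ?mulg1.
Qed.

Lemma sgen_far i j : 0 < i < n -> 0 < j < n -> far i j ->
  sgen n i * sgen n j = sgen n j * sgen n i.
Proof.
move=> hi hj ij; apply/permP=> x; apply: val_inj; rewrite !permM /= !sgen_val //.
by rewrite /far in ij; do !case: eqP => //=; lia.
Qed.

Lemma sgen_braid i : 0 < i -> i.+1 < n ->
  sgen n i * sgen n i.+1 * sgen n i = sgen n i.+1 * sgen n i * sgen n i.+1.
Proof.
move=> i0 ltin; apply/permP=> x; apply: val_inj; rewrite !permM /= !sgen_val; try lia.
by do !case: eqP => //=; lia.
Qed.

Lemma sgen_neq i : 0 < i -> i.+1 < n -> sgen n i <> sgen n i.+1.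
Proof.
move=> i0 ltin /permP/(_ (Ordinal ltin))/(congr1 val) /=.
by rewrite !sgen_val /=; do ?case: eqP; lia.
Qed.

Lemma ltimesK i w : ltimes n i (ltimes n i w) = w.
Proof. exact/twistK/sgen_sq. Qed.

Lemma ev_cat l1 l2 : ev n (l1 ++ l2) = foldr (ltimes n) (ev n l2) l1.
Proof. exact: foldr_cat. Qed.

Lemma ev_sq l : ev n l * ev n l = 1.
Proof. by elim: l => [|i l IH]; [exact: mulg1|apply: twist_sq (sgen_sq i) IH]. Qed.

Lemma valid_cat l1 l2 : valid n (l1 ++ l2) = valid n l1 && valid n l2.
Proof. exact: all_cat. Qed.

Lemma ev_far i j l : 0 < i < n -> 0 < j < n -> far i j ->
  ev n [:: i, j & l] = ev n [:: j, i & l].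
Proof.
by move=> hi hj ij; apply: twist_commute (sgen_sq i) (sgen_sq j) _; exact: sgen_far.
Qed.

(** In the second case both words have equivalents two letters shorter, so neither ends a reduced
    word. *)
Lemma ev_braid j l : 0 < j -> j.+1 < n ->
  ev n [:: j, j.+1, j & l] = ev n [:: j.+1, j, j.+1 & l] \/
  ev n [:: j, j.+1, j & l] = ev n (j.+1 :: l) /\
  ev n [:: j.+1, j, j.+1 & l] = ev n (j :: l).
Proof.
move=> j0 jn.
have [e|e] := @twist_braid _ _ _ (ev n l) (sgen_sq j) (sgen_sq j.+1)
  (sgen_braid _ j0 jn) (sgen_neq _ j0 jn) (ev_sq l); [by left|right].
move: e; rewrite -!ltimesE => e; split; first exact: e.
by rewrite /= -/(ev n l) -e !ltimesK.
Qed.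

(** The inner letter acts on 1 by multiplication and the outer one by conjugation, which gives the
    braid relation. *)
Lemma ev_end k : 0 < k -> k.+1 < n -> ev n [:: k; k.+1] = ev n [:: k.+1; k].
Proof.
move=> k0 kn; rewrite /= !ltimesE !(twist_comm _ 1) ?mulg1 ?mul1g //.
have nc : sgen n k * sgen n k.+1 <> sgen n k.+1 * sgen n k.
  move=> e; apply: (sgen_neq _ k0 kn); move: (sgen_braid _ k0 kn).
  by rewrite e -!mulgA sgen_sq e mulg1 mulgA sgen_sq mul1g => /esym.
rewrite !twist_conj ?sgen_braid //; exact/nesym.
Qed.

(** A shorter [y] could replace [x] behind the prefix [a]. *)
Lemma reduced_cat_le a x y : reduced n (a ++ x) -> valid n y ->
  ev n x = ev n y -> size x <= size y.
Proof.
move=> [va H] vy e; have := H (a ++ y); rewrite !size_cat leq_add2l; apply.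
move: va; rewrite /is_expr !valid_cat => /andP[-> _]; split=> //.
by rewrite !ev_cat e.
Qed.

Lemma reduced_square a j b : ~ reduced n (a ++ [:: j, j & b]).
Proof.
move=> r; have /= := reduced_cat_le _ _ b r; rewrite ltimesK ltnNge leqnSn /=.
move=> H; suff: false by []. apply: H => //.
by case: r; rewrite valid_cat /= => /andP[_ /and3P[]].
Qed.

Lemma braid_move_raw_reduced l l' : reduced n l -> braid_move_raw n l l' ->
  ev n l' = ev n l /\ reduced n l'.
Proof.
move=> rl H.
suff: ev n l' = ev n l /\ [/\ valid n l' = valid n l & size l' = size l].
  move=> [e [v s]]; split=> //; case: rl => vl ml.
  by split; rewrite ?v ?e ?s.
have vl : valid n l by case: rl.
case: H => [[a [b [j [j0 [jn H]]]]]|[[a [r [b [c [bc [el el']]]]]]|[a [k [k0 [kn H]]]]]].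
- have short i x y z : 0 < i < n -> l = a ++ [:: x, y, z & b] ->
      ev n [:: x, y, z & b] <> ev n (i :: b).
    move=> hi lE e; rewrite lE in rl vl.
    have /= := reduced_cat_le _ _ (i :: b) rl _ e; rewrite hi.
    by move: vl; rewrite valid_cat /= => /and5P[_ _ _ _ ->] /(_ isT); lia.
  have [e|[e1 e2]] := ev_braid j b j0 jn; last first.
    have [hj hj1] : 0 < j < n /\ 0 < j.+1 < n by lia.
    by case: H => -[el _]; [case: (short _ _ _ _ hj1 el)|case: (short _ _ _ _ hj el)].
  case: H => -[-> ->]; rewrite !ev_cat !valid_cat !size_cat /= -/(ev n b).
    by rewrite -[LHS]/(foldr _ (ev n [:: j.+1, j, j.+1 & b]) a) -e; do !split=> //; lia.
  by rewrite -[LHS]/(foldr _ (ev n [:: j, j.+1, j & b]) a) e; do !split=> //; lia.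
- move: vl; rewrite el el' /= !ev_cat !valid_cat /= => /and4P[_ hb hc _].
  rewrite !size_cat hb hc; split=> //; congr foldr.
  by apply: ev_far => //; apply/orP; case: bc; auto.
- by case: H => -[-> ->]; rewrite !ev_cat (ev_end k) // !valid_cat !size_cat;
    do !split=> //=; lia.
Qed.

(** * Normal words are determined by their values *)

Lemma ltimes_fix i w (x : 'I_n) : 0 < i < n -> i < x -> w x = x -> ltimes n i w x = x.
Proof.
move=> hi ix wx.
have sx : sgen n i x = x.
  by apply: val_inj; rewrite /= sgen_val //; do !case: eqP => //; lia.
by rewrite /ltimes; case: ifP => _; rewrite !permM !(sx, wx).
Qed.

Lemma ev_fix l (x : 'I_n) : valid n l -> all (fun i => i < x) l -> ev n l x = x.
Proof.
elim: l => [|i l IH] /=; first by rewrite perm1.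
by case/andP=> hi vl /andP[ix lx]; apply: ltimes_fix => //; apply: IH.
Qed.

(** Points are 0-based here. The last letter of the run creates the 2-cycle of the two top points;
    each earlier letter conjugates and lowers the partner of [x] by 1. *)
Lemma ev_run m N r (x : 'I_n) : 0 < m < N -> x.+1 = N -> normal_word N.-2 r ->
  ev n (run m N ++ r) x = m.-1 :> nat.
Proof.
move=> mN xN nr; have [d dE] : {d | d = N - m} by exists (N - m).
have Nn : N <= n by rewrite -xN.
elim: d => [|d IH] in m mN dE *; first by lia.
have rfix (y : 'I_n) : N.-2 <= y -> ev n r y = y.
  have vr := normal_lt _ _ nr.
  move=> Ny; apply: ev_fix; apply: sub_all vr => i; lia.
rewrite run_cons /=; last by lia.
have [mN1|mN1] := eqVneq m.+1 N.
  rewrite mN1 run_nil /=.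
  have sfix (y : 'I_n) : y < N.-2 -> sgen n m y = y.
    by move=> yN; apply: val_inj; rewrite /= sgen_val; last lia; do !case: eqP => //; lia.
  (* The generator moves only two points, both fixed by [r]. *)
  have e : ltimes n m (ev n r) = sgen n m * ev n r.
    apply: twist_comm; apply/permP=> y; rewrite !permM.
    have [yN|Ny] := leqP N.-2 y.
      rewrite [in RHS]rfix // rfix // sgen_val; last by lia.
      by do !case: eqP => //; lia.
    have fy : ev n r y < N.-2.
      by rewrite ltnNge; apply/negP=> le; move: (le); rewrite (perm_inj (rfix _ le)); lia.
    by rewrite !sfix.
  rewrite -/(ev n r) e permM rfix sgen_val; try lia.
    by case: eqP => //; lia.
  by do !case: eqP => //; lia.
have {}IH := IH m.+1 _ _; rewrite /= in IH.
rewrite -/(ev n (run m.+1 N ++ r)) in IH *; set w := ev n _ in IH *.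
have wx : w x = m :> nat by apply: IH; lia.
have sx : sgen n m x = x.
  by apply: val_inj; rewrite /= sgen_val; last lia; do !case: eqP => //; lia.
have swx : sgen n m (w x) = m.-1 :> nat by rewrite sgen_val ?wx ?eqxx //; lia.
rewrite ltimesE twist_conj ?permM ?sx //.
move/permP/(_ x)/(congr1 val); rewrite !permM /= sx swx wx; lia.
Qed.

Lemma ev_run_neq B m N r z : 0 < m < N -> N <= n -> normal_word N.-2 r ->
  B < N -> normal_word B z -> ev n z <> ev n (run m N ++ r).
Proof.
move=> mN Nn nr BN nz; have Nn1 : N.-1 < n by lia.
move/permP/(_ (Ordinal Nn1))/(congr1 val) => /=.
rewrite (ev_run _ _ _ _ mN _ nr) /=; last by lia.
by rewrite ev_fix /=; [lia|..]; apply: sub_all (normal_lt _ _ nz) => i /=; lia.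
Qed.

Lemma normal_ev_inj B x y : B <= n -> normal_word B x -> normal_word B y ->
  ev n x = ev n y -> x = y.
Proof.
move=> Bn nx; elim: nx Bn y => {B x} [B|B m N r mN NB nr IH] Bn y ny.
  case: ny Bn => {B} // B m N r mN NB nr Bn.
  by move/(ev_run_neq 0 m N r [::] mN _ nr _ (normal_nil 0)); lia.
(* Bounding each word by its own top [N] allows [ev_run_neq] to compare different tops. *)
have nx := normal_run N _ _ _ mN (leqnn N) nr.
case: ny NB Bn => {B} [B|B m' N' r' mN' NB' nr'] NB Bn e.
  by case: (ev_run_neq 0 m N r [::]); rewrite ?e //; [lia..|exact: normal_nil].
have ny := normal_run N' _ _ _ mN' (leqnn N') nr'.
have [lt|lt|NN] := ltngtP N N'.
- by case: (ev_run_neq N m' N' r' (run m N ++ r)) => //; lia.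
- by case: (ev_run_neq N' m N r (run m' N' ++ r')) => //; lia.
subst N'; have Nn1 : N.-1 < n by lia.
have mm : m = m'.
  move/permP/(_ (Ordinal Nn1))/(congr1 val): (e).
  by rewrite /= !ev_run //=; lia.
subst m'; congr (_ ++ _); apply: IH => //; first by lia.
(* The common run is cancelled letter by letter, each letter acting invertibly. *)
move: e; rewrite !ev_cat; elim: (run m N) => //= i l IHl e.
by apply: IHl; rewrite -(ltimesK i (foldr _ _ l)) e ltimesK.
Qed.

End Perms.

Theorem theorem3p1 (n : nat) (w : {perm 'I_n}) (l l' : seq nat) :
  w * w = 1 ->
  reduced n l -> is_expr n l w ->
  reduced n l' -> is_expr n l' w ->
  clos_refl_trans_1n (seq nat) (braid_move_for n w) l l'.
Proof.
move=> _ rl el rl' el'.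
have reduced_eq x y : reduced n x -> braid_eq n x y -> ev n y = ev n x /\ reduced n y.
  move=> rx xy; elim: xy rx => {x y} [x y xy rx|x rx|x y z _ IH1 _ IH2 rx].
  - exact: braid_move_raw_reduced.
  - by [].
  - by have [<- /IH2] := IH1 rx.
have normal_form x : reduced n x -> is_expr n x w ->
    exists2 y, normal_word n y & braid_eq n x y /\ ev n y = w.
  move=> rx [vx ex]; have [[y ny xy]|[a [j [b xj]]]] := valid_normalizable n x vx.
    by exists y => //; split=> //; rewrite -ex; case: (reduced_eq x y).
  by case: (reduced_square n a j b); case: (reduced_eq _ _ rx xj).
have [y ny [ly ey]] := normal_form l rl el.
have [y' ny' [ly' ey']] := normal_form l' rl' el'.
have yy : y = y' by apply: (normal_ev_inj n n) => //; rewrite ey.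
have ll : braid_eq n l l'.
  by apply: (braid_eq_trans n y) => //; rewrite yy; apply: braid_eq_sym.
have {ll} H := clos_rt_rt1n _ _ _ _ ll.
(* Reducedness and value are carried along the chain from [l], so each raw move is a braid move for
   [w]. *)
elim: H rl el {ly rl' el' ly'} => [x|x z y'' xz _ IH] rx ex; first exact: rt1n_refl.
have [ez rz] := braid_move_raw_reduced n x z rx xz.
have exz : is_expr n z w by case: rz ex => vz _ [_ <-]; split.
by apply: Relation_Operators.rt1n_trans (IH rz exz).
Qed.
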